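(* Let $x^\star$ be an optimizer of $(\mathcal P)$ and $y_n^\star$ an optimizer of $(\mathcal D_n)$, and let $r_n:=x^\star-\Pi_{\mathsf B_n}(x^\star)$ be the projection residual of $x^\star$ onto $\mathsf B_n:=\{\sum_{i=1}^n\alpha_ix_i:\ \|\alpha\|_{\mathfrak R}\le\theta_{\mathcal P}\}$, where $\Pi_{\mathsf B_n}(x)\in\arg\min_{x'\in\mathsf B_n}\|x'-x\|$. If $(\mathcal P_n)$ is feasible, then $$0\le J_n-J\le\langle r_n,\mathcal A^*y_n^\star-c\rangle .$$ If in addition there is $\gamma>0$ with $\|\mathcal A_n^*y\|_{\mathfrak R^*}\ge\gamma\|y\|_*$ for all $y\in\mathbb K^*$ and $\gamma\theta_{\mathcal P}>\|b\|$, then $$0\le J_n-J\le\big(\|c\|_*+\theta_{\mathcal D}\|\mathcal A\|\big)\|r_n\|,\qquad \theta_{\mathcal D}:=\frac{\theta_{\mathcal P}\|\mathbf c\|_{\mathfrak R^*}-J_n^{\rm LB}}{\gamma\theta_{\mathcal P}-\|b\|},$$ where $J_n^{\rm LB}\le J_n$ is any lower bound.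
   Context: Dual pairs: $\mathbb X,\mathbb C$ are real vector spaces with a bilinear form $\langle\cdot,\cdot\rangle$ on $\mathbb X\times\mathbb C$ separating points on both sides; $\mathbb X$ carries a norm $\|\cdot\|$ (not necessarily complete), which induces the dual norm $\|c\|_*:=\sup_{\|x\|\le1}\langle x,c\rangle$ on $\mathbb C$. $(\mathbb B,\mathbb Y,\|\cdot\|)$ is another such dual pair (same notation). $\mathcal A:\mathbb X\to\mathbb B$ is linear and continuous with respect to the weak topologies (the weakest topologies for which the topological duals of $\mathbb X$, $\mathbb B$ are $\mathbb C$, $\mathbb Y$), with adjoint $\mathcal A^*:\mathbb Y\to\mathbb C$, $\langle\mathcal Ax,y\rangle=\langle x,\mathcal A^*y\rangle$, and operator norm $\|\mathcal A\|:=\sup_{\|x\|\le1}\|\mathcal Ax\|$. $\mathbb K\subset\mathbb B$ is a convex cone, closed in the weak topology, with dual cone $\mathbb K^*:=\{y\in\mathbb Y:\langle z,y\rangle\ge0\ \forall z\in\mathbb K\}$. $c\in\mathbb C$, $b\in\mathbb B$ are fixed; $z\succeq_{\mathbb K}b$ means $z-b\in\mathbb K$. $(\mathcal P)$: $J:=\inf\{\langle x,c\rangle:\ x\in\mathbb X,\ \mathcal Ax\succeq_{\mathbb K}b\}$, assumed to have an optimizer. Let $x_1,\dots,x_n\in\mathbb X$ be linearly independent with $\|x_i\|=1$, let $\|\cdot\|_{\mathfrak R}$ be a norm on $\mathbb R^n$ with dual norm $\|\cdot\|_{\mathfrak R^*}$, and $\theta_{\mathcal P}>0$. Write $\alpha\cdot\beta$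 for the standard inner product. Define $\mathcal A_n\alpha:=\sum_{i=1}^n\alpha_i\mathcal Ax_i$, $\mathcal A_n^*y:=[\langle\mathcal Ax_1,y\rangle,\dots,\langle\mathcal Ax_n,y\rangle]$, $\mathbf c:=[\langle x_1,c\rangle,\dots,\langle x_n,c\rangle]$. $(\mathcal P_n)$: $J_n:=\inf\{\alpha\cdot\mathbf c:\ \alpha\in\mathbb R^n,\ \mathcal A_n\alpha\succeq_{\mathbb K}b,\ \|\alpha\|_{\mathfrak R}\le\theta_{\mathcal P}\}$. $(\mathcal D_n)$: $\sup\{\langle b,y\rangle-\theta_{\mathcal P}\|\mathcal A_n^*y-\mathbf c\|_{\mathfrak R^*}:\ y\in\mathbb K^*\}$. *)

(* Defs.v *)
From HB Require Import structures.
From mathcomp Require Import all_boot all_order all_algebra.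
From mathcomp Require Import all_classical all_reals all_analysis.

Set Implicit Arguments.
Unset Strict Implicit.
Unset Printing Implicit Defensive.

Import Order.TTheory GRing.Theory Num.Theory.
Import numFieldNormedType.Exports.

Local Open Scope classical_set_scope.
Local Open Scope ring_scope.

Definition minimizer {d : Order.disp_t} {U : porderType d} {T : Type}
    (D : set T) (f : T -> U) (x : T) : Prop :=
  D x /\ forall x', D x' -> (f x <= f x')%O.

Definition maximizer {d : Order.disp_t} {U : porderType d} {T : Type}
    (D : set T) (f : T -> U) (x : T) : Prop :=
  D x /\ forall x', D x' -> (f x' <= f x)%O.

Definition separating {R : realType} {X C : lmodType R}
    (p : {bilinear X -> C -> R | *%R & *%R}) : Prop :=
  (forall x, (forall c, p x c = 0) -> x = 0) /\
  (forall c, (forall x, p x c = 0) -> c = 0).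

(* The topology sigma(X, C): initial for x |-> (c |-> <x, c>), where R^C has
   the topology of pointwise convergence. *)
Definition weak {R : realType} {X C : lmodType R}
    (p : {bilinear X -> C -> R | *%R & *%R}) : topologicalType :=
  initial_topology ((fun x c => p x c) : X -> {ptws C -> R}).

Definition weakly_closed {R : realType} {X C : lmodType R}
    (p : {bilinear X -> C -> R | *%R & *%R}) (D : set X) : Prop :=
  @closed (weak p) D.

Definition weakly_continuous {R : realType} {X C B Y : lmodType R}
    (p : {bilinear X -> C -> R | *%R & *%R})
    (q : {bilinear B -> Y -> R | *%R & *%R}) (A : X -> B) : Prop :=
  forall x : weak p, @continuous_at (weak p) (weak q) x A.

(* Extended-real valued: C need not consist of norm-bounded functionals, so
   the supremum may be +oo. *)
Definition dual_norm {R : realType} {X C : Type} (N : X -> R) (p : X -> C -> R)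
    (c : C) : \bar R :=
  ereal_sup [set (p x c)%:E | x in [set x | N x <= 1]].

Definition op_norm {R : realType} {X B : normedModType R} (A : X -> B) :
    \bar R :=
  ereal_sup [set (`|A x|)%:E | x in [set x | `|x| <= 1]].

Definition adjoint_of {R : realType} {X C B Y : lmodType R}
    (p : {bilinear X -> C -> R | *%R & *%R})
    (q : {bilinear B -> Y -> R | *%R & *%R})
    (A : X -> B) (Astar : Y -> C) : Prop :=
  forall x y, q (A x) y = p x (Astar y).

Definition convex_cone {R : realType} {B : lmodType R} (K : set B) : Prop :=
  convex_set (K : set (convex_lmodType B)) /\
  forall (t : R) z, 0 <= t -> K z -> K (t *: z).

Definition dual_cone {R : realType} {B Y : lmodType R}
    (q : {bilinear B -> Y -> R | *%R & *%R}) (K : set B) : set Y :=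
  [set y | forall z, K z -> 0 <= q z y].

Definition is_norm {R : realType} {V : lmodType R} (N : V -> R) : Prop :=
  [/\ forall v, N v = 0 -> v = 0,
      forall (t : R) v, N (t *: v) = `|t| * N v
    & forall v w, N (v + w) <= N v + N w].

Definition lin_indep {R : realType} {X : lmodType R} {n : nat}
    (x : 'I_n -> X) : Prop :=
  forall a : 'rV[R]_n, \sum_i a ord0 i *: x i = 0 -> a = 0.

Definition dotv {R : realType} {n : nat} (a e : 'rV[R]_n) : R :=
  \sum_i a ord0 i * e ord0 i.

Definition feasP {R : realType} {X B : lmodType R}
    (A : X -> B) (K : set B) (b : B) : set X :=
  [set x | K (A x - b)].

Definition inf_P {R : realType} {X C B : lmodType R}
    (p : {bilinear X -> C -> R | *%R & *%R})
    (A : X -> B) (K : set B) (c : C) (b : B) : \bar R :=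
  ereal_inf [set (p x c)%:E | x in feasP A K b].

Definition An {R : realType} {X B : lmodType R} {n : nat}
    (A : X -> B) (x : 'I_n -> X) (a : 'rV[R]_n) : B :=
  \sum_i a ord0 i *: A (x i).

Definition An_adj {R : realType} {X B Y : lmodType R} {n : nat}
    (q : {bilinear B -> Y -> R | *%R & *%R})
    (A : X -> B) (x : 'I_n -> X) (y : Y) : 'rV[R]_n :=
  \row_i q (A (x i)) y.

Definition cvec {R : realType} {X C : lmodType R} {n : nat}
    (p : {bilinear X -> C -> R | *%R & *%R})
    (x : 'I_n -> X) (c : C) : 'rV[R]_n :=
  \row_i p (x i) c.

Definition feasPn {R : realType} {X B : lmodType R} {n : nat}
    (A : X -> B) (K : set B) (b : B)
    (x : 'I_n -> X) (N : 'rV[R]_n -> R) (thetaP : R) : set 'rV[R]_n :=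
  [set a | K (An A x a - b) /\ N a <= thetaP].

Definition inf_Pn {R : realType} {X C B : lmodType R} {n : nat}
    (p : {bilinear X -> C -> R | *%R & *%R})
    (A : X -> B) (K : set B) (c : C) (b : B)
    (x : 'I_n -> X) (N : 'rV[R]_n -> R) (thetaP : R) : \bar R :=
  ereal_inf [set (dotv a (cvec p x c))%:E | a in feasPn A K b x N thetaP].

Definition objDn {R : realType} {X C B Y : lmodType R} {n : nat}
    (p : {bilinear X -> C -> R | *%R & *%R})
    (q : {bilinear B -> Y -> R | *%R & *%R})
    (A : X -> B) (c : C) (b : B)
    (x : 'I_n -> X) (N : 'rV[R]_n -> R) (thetaP : R) (y : Y) : \bar R :=
  ((q b y)%:E
   - thetaP%:E * dual_norm N dotv (An_adj q A x y - cvec p x c)%R)%E.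

Definition Bn {R : realType} {X : lmodType R} {n : nat}
    (x : 'I_n -> X) (N : 'rV[R]_n -> R) (thetaP : R) : set X :=
  [set \sum_i a ord0 i *: x i | a in [set a : 'rV[R]_n | N a <= thetaP]].

Definition thetaD {R : realType} {X C : lmodType R} {B : normedModType R}
    {n : nat} (p : {bilinear X -> C -> R | *%R & *%R}) (c : C) (b : B)
    (x : 'I_n -> X) (N : 'rV[R]_n -> R) (thetaP gamma JLB : R) : \bar R :=
  ((thetaP%:E * dual_norm N dotv (cvec p x c) - JLB%:E)
   / (gamma * thetaP - `|b|)%:E)%E.

(* Main.v *)
Require Import Defs.
From HB Require Import structures.
From mathcomp Require Import all_boot all_order all_algebra.
From mathcomp Require Import all_classical all_reals all_analysis.
From mathcomp Require Import ring lra.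
Import Order.TTheory GRing.Theory Num.Theory.
Import numFieldNormedType.Exports.
Local Open Scope classical_set_scope.
Local Open Scope ring_scope.

(** The program (P_n) has no duality gap.  If finitely many affine functions
    on a convex set have a nonnegative maximum everywhere, then some convex
    combination of them is nonnegative everywhere; this is proved by induction
    on their number.  It separates a point from a weakly closed convex cone,
    since a weak neighbourhood involves only finitely many functionals.  Hence
    for [t < J_n] every [alpha] in the compact ball admits a multiplier at which
    the Lagrangian exceeds [t]; finitely many multipliers suffice by
    compactness, and the same fact merges them into a single one.  Both error
    bounds then follow by testing the optimal dual value against the
    coefficients of the projection of [xopt]. *)

(** * Affine functions on convex sets and a finite minimax statement *)

Definition affine_fun {R : realType} {V : lmodType R} (f : V -> R) : Prop :=
  forall (s t : R) u v, s + t = 1 -> f (s *: u + t *: v) = s * f u + t * f v.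

Lemma convex_setP (R : realType) (V : lmodType R) (D : set V) :
  convex_set (D : set (convex_lmodType V)) <->
  forall (s t : R) u v, 0 <= s -> 0 <= t -> s + t = 1 ->
    D u -> D v -> D (s *: u + t *: v).
Proof.
split=> [cD s t u v s0 t0 st Du Dv|cD u v l /set_mem Du /set_mem Dv].
  have s1 : s <= 1 by rewrite -st lerDl.
  have -> : t = 1 - s by rewrite -st addrC addKr.
  exact: set_mem (cD u v (Itv01 s0 s1) (mem_set Du) (mem_set Dv)).
apply/mem_set; apply: (cD l%:num (1 - l%:num)) => //.
by rewrite addrC subrK.
Qed.

(* If the inequality failed, both functions would be negative at the convex
   combination of [u] and [v] with weights proportional to [f v - g v] and
   [g u - f u]. *)
Lemma affine_max_ge0_cross (R : realType) (V : lmodType R) (D : set V)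
    (f g : V -> R) (u v : V) :
  convex_set (D : set (convex_lmodType V)) -> affine_fun f -> affine_fun g ->
  (forall w, D w -> 0 <= f w \/ 0 <= g w) ->
  D u -> D v -> f u < 0 -> g v < 0 -> g v * f u <= g u * f v.
Proof.
move=> /convex_setP cD af ag fg Du Dv fu gv.
have gu : 0 <= g u by case: (fg _ Du) => //; rewrite leNgt fu.
have fv : 0 <= f v by case: (fg _ Dv) => //; rewrite leNgt gv.
rewrite leNgt; apply/negP => H.
pose m := f v - g v; pose k := g u - f u.
have m0 : 0 < m by rewrite /m; lra.
have k0 : 0 < k by rewrite /k; lra.
have mk0 : 0 < m + k by rewrite addr_gt0.
pose s := m / (m + k); pose t := k / (m + k).
have st : s + t = 1 by rewrite /s /t -mulrDl divff// gt_eqF.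
have s0 : 0 <= s by rewrite /s divr_ge0 ?ltW.
have t0 : 0 <= t by rewrite /t divr_ge0 ?ltW.
have Dw := cD _ _ _ _ s0 t0 st Du Dv.
have E (h : V -> R) : affine_fun h ->
    h (s *: u + t *: v) = (m * h u + k * h v) / (m + k).
  by move=> ah; rewrite ah// /s /t [RHS]mulrDl; congr (_ + _); rewrite mulrAC.
(* With these weights [f] and [g] take the same value [(g u * f v - g v * f u) / (m + k)], which is
   negative by [H]. *)
by case: (fg _ Dw); rewrite E// pmulr_lge0 ?invr_gt0// /m /k; nra.
Qed.

(** Points where [g < 0] bound the weight of [f] from below, points where [f < 0] bound it from
    above. The cross inequality puts each lower bound below each upper bound, so the supremum of the
    lower bounds is admissible. *)
Lemma affine_max2_ge0 (R : realType) (V : lmodType R) (D : set V)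
    (f g : V -> R) :
  convex_set (D : set (convex_lmodType V)) -> affine_fun f -> affine_fun g ->
  (forall w, D w -> 0 <= f w \/ 0 <= g w) ->
  exists s t : R, [/\ 0 <= s, 0 <= t, s + t = 1 &
    forall w, D w -> 0 <= s * f w + t * g w].
Proof.
move=> cD af ag fg.
(* [s] must lie above every element of [L] and below [g u / (g u - f u)]
   whenever [f u < 0]. *)
pose L : set R := [set 0] `|`
  [set - g v / (f v - g v) | v in [set v | D v /\ g v < 0]].
have Lub (y : R) : 0 <= y ->
    (forall v, D v -> g v < 0 -> - g v <= y * (f v - g v)) -> ubound L y.
  move=> y0 H _ [->//|[v [Dv gv] <-]].
  have fv : 0 <= f v by case: (fg _ Dv) => //; rewrite leNgt gv.
  by rewrite ler_pdivrMr ?H// subr_gt0; lra.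
have L1 : ubound L 1.
  apply: Lub => // v Dv gv.
  have fv : 0 <= f v by case: (fg _ Dv) => //; rewrite leNgt gv.
  by lra.
have sL : has_sup L by split; [exists 0; left|exists 1].
have s0 : 0 <= sup L by apply: sup_upper_bound => //; left.
have s1 : sup L <= 1 by apply: sup_le_ub => //; case: sL.
exists (sup L), (1 - sup L); split=> //; first by rewrite subr_ge0.
  by rewrite addrC subrK.
move=> w Dw.
have [fw|fw] := ltP (f w) 0.
  have gw : 0 <= g w by case: (fg _ Dw) => //; rewrite leNgt fw.
  have d0 : 0 < g w - f w by lra.
  suff : sup L <= g w / (g w - f w) by rewrite ler_pdivlMr//; lra.
  apply: sup_le_ub; first by case: sL.
  apply: Lub => [|v Dv gv]; first by rewrite divr_ge0// ltW.
  rewrite mulrAC ler_pdivlMr//.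
  by have := affine_max_ge0_cross _ _ _ _ _ _ _ cD af ag fg Dw Dv fw gv; lra.
have [gw|gw] := ltP (g w) 0; last first.
  by rewrite addr_ge0// mulr_ge0// subr_ge0.
have d0 : 0 < f w - g w by lra.
have : - g w / (f w - g w) <= sup L.
  by apply: sup_upper_bound => //; right; exists w.
by rewrite ler_pdivrMr//; lra.
Qed.

(** Where the head [w] of the list gives a negative value, the tail must succeed, so induction
    yields a single [w'] there. Affinity in [v] keeps that region convex; affinity in [w] turns the
    combination of the functions for [w] and [w'] into the function of one point of [E]. *)
Lemma finite_minimax (R : realType) (V W : lmodType R) (D : set V) (E : set W)
    (F : V -> W -> R) (ws : seq W) :
  convex_set (D : set (convex_lmodType V)) ->
  convex_set (E : set (convex_lmodType W)) -> E !=set0 ->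
  (forall w, affine_fun (F^~ w)) -> (forall v, affine_fun (F v)) ->
  (forall w, w \in ws -> E w) ->
  (forall v, D v -> exists2 w, w \in ws & 0 <= F v w) ->
  exists2 w, E w & forall v, D v -> 0 <= F v w.
Proof.
move=> cD /convex_setP cE [w0 Ew0] aV aW.
elim: ws D cD => [|w ws IH] D cD wsE DF.
  (* The hypothesis on an empty list forces [D] to be empty. *)
  by exists w0 => // v /DF[].
have [|||w' Ew' Hw'] := IH (D `&` [set v | F v w < 0]).
- apply/convex_setP => s t u v s0 t0 st [Du /= Fu] [Dv /= Fv]; split.
    by move/convex_setP: cD; apply.
  (* Strict negativity comes from the term of weight [s > 0]; for [s = 0] it comes from [v]
     alone. *)
  rewrite /= (aV w)//; move: s0; rewrite le_eqVlt => /predU1P[s0|s0].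
    by move: st; rewrite -s0 add0r => ->; rewrite mul0r add0r mul1r.
  by rewrite ltr_wnDr ?pmulr_rlt0// mulr_ge0_le0// ltW.
- by move=> w1 w1s; apply: wsE; rewrite inE w1s orbT.
- move=> v [/DF[w1]]; rewrite inE => /predU1P[->|w1s] Fv /= Fw.
    by rewrite ltNge Fv in Fw.
  by exists w1.
have [|s [t [s0 t0 st H]]] := affine_max2_ge0 _ _ _ _ _ cD (aV w) (aV w').
  move=> v Dv; have [Fv|Fv] := leP 0 (F v w); [by left|right].
  exact: Hw'.
exists (s *: w + t *: w'); first by apply: cE => //; apply: wsE; rewrite inE eqxx.
by move=> v Dv; rewrite (aW v)//; exact: H.
Qed.

(** * Weak neighbourhoods and separation from a weakly closed cone *)

Lemma weak_nbhsP (R : realType) (B Y : lmodType R)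
    (q : {bilinear B -> Y -> R | *%R & *%R}) (z0 : B) (U : set B) :
  nbhs (z0 : weak q) U ->
  exists ys : seq Y, exists2 e : R, 0 < e &
    forall z, (forall y, y \in ys -> `|q z y - q z0 y| < e) -> U z.
Proof.
pose I := [set i : seq Y * R | 0 < i.2].
pose S (i : seq Y * R) :=
  [set z | forall y, y \in i.1 -> `|q z y - q z0 y| < i.2].
pose G := filter_from I S.
have GF : Filter G.
  apply: filter_from_filter; first by exists ([::], 1) => /=; rewrite /I/= ltr01.
  move=> [ys e] [zs d] /= e0 d0; exists (ys ++ zs, Num.min e d).
    by rewrite /I /= lt_min; apply/andP; split.
  move=> z /= H; split=> y yin /=.
    by have := H y; rewrite mem_cat yin lt_min => /(_ isT)/andP[].
  by have := H y; rewrite mem_cat yin orbT lt_min => /(_ isT)/andP[].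
(* Along [G] each [q z y] tends to [q z0 y], so the evaluation map converges pointwise; the initial
   topology then places every weak neighbourhood of [z0] in [G]. *)
suff GU : nbhs (z0 : weak q) `<=` G.
  by move=> /GU [[ys e] /= e0 H]; exists ys, e.
move=> A [_ [[P Pop <-] Pz0 sPA]].
have cvgG :
    {ptws, ((fun z y => q z y) : B -> (Y -> R)) @ G --> (fun y => q z0 y)}.
  apply/cvg_sup => y A' [_ [[Q Qop <-] Qz0 sQA']].
  have /nbhs_ballP[e /= e0 eQ] : nbhs (q z0 y) Q by apply: open_nbhs_nbhs.
  exists ([:: y], e) => //= z /(_ y); rewrite inE eqxx => /(_ isT) qzy.
  by apply/sQA'/eQ; rewrite /ball/= distrC.
have : nbhs ((fun y => q z0 y) : {ptws Y -> R}) P by apply: open_nbhs_nbhs.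
by move=> /cvgG; exact: (filterS sPA).
Qed.

Lemma bilinear_affinel (R : realType) (B Y : lmodType R)
    (q : {bilinear B -> Y -> R | *%R & *%R}) y : affine_fun (q^~ y).
Proof. by move=> s t u v _; rewrite linearDl/= !linearZl_LR. Qed.

Lemma bilinear_affiner (R : realType) (B Y : lmodType R)
    (q : {bilinear B -> Y -> R | *%R & *%R}) z : affine_fun (q z).
Proof. by move=> s t u v _; rewrite linearDr/= !linearZr_LR. Qed.

Lemma dual_cone_separation (R : realType) (B Y : lmodType R)
    (q : {bilinear B -> Y -> R | *%R & *%R}) (K : set B) (z0 : B) :
  convex_cone K -> weakly_closed q K -> K !=set0 -> ~ K z0 ->
  exists2 y, dual_cone q K y & q z0 y < 0.
Proof.
move=> [cK coneK] clK [k0 Kk0] Kz0.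
have /weak_nbhsP[ys [e e0 H]] : nbhs (z0 : weak q) (~` K).
  by apply: open_nbhs_nbhs; split=> //; exact: closed_openC.
pose F z y := q z y - q z0 y - e.
(* A point of [K] lies outside the neighbourhood, so some [y] in [ys] has [|q z y - q z0 y| >= e].
   Adding the opposites of [ys] makes this one-sided, hence affine. *)
have [|||||||y _ Fy] := @finite_minimax _ _ _ K setT F (ys ++ map -%R ys).
- exact: cK.
- by apply/convex_setP.
- by exists 0.
- move=> y s t u v st; rewrite /F (bilinear_affinel _ _ _ q y)//.
  have -> : t = 1 - s by lra.
  by ring.
- move=> z s t u v st; rewrite /F !(bilinear_affiner _ _ _ q)//.
  have -> : t = 1 - s by lra.
  by ring.
- by [].
- move=> z Kz; apply: contrapT => nF; apply: (H z) => // y yin.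
  rewrite ltNge; apply/negP; rewrite ler_normr => /orP[] le; apply: nF.
    by exists y; rewrite ?mem_cat ?yin// /F; lra.
  exists (- y); first by rewrite mem_cat map_f ?orbT.
  by rewrite /F !linearNr/=; lra.
have K0 : K 0 by rewrite -(scale0r k0); exact: coneK.
have qz0 : q z0 y <= - e by have := Fy _ K0; rewrite /F linear0l; lra.
exists y; last by apply: le_lt_trans qz0 _; rewrite oppr_lt0.
move=> z Kz; rewrite leNgt; apply/negP => qz.
(* With this factor [q (t *: z) y = q z0 y], so [F] would equal [- e] at a point of the cone. *)
pose t := (q z0 y) / (q z y).
have t0 : 0 <= t by rewrite /t; apply: mulr_le0; [lra|rewrite invr_le0 ltW].
have := Fy _ (coneK t z t0 Kz); rewrite /F linearZl_LR/= /t divfK ?lt_eqF//.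
by lra.
Qed.

(** * Norms on row vectors: equivalence and compact balls *)

Lemma is_norm0 (R : realType) (V : lmodType R) (N : V -> R) :
  is_norm N -> N 0 = 0.
Proof. by case=> _ NZ _; rewrite -(scale0r 0) NZ normr0 mul0r. Qed.

Lemma is_normN (R : realType) (V : lmodType R) (N : V -> R) (v : V) :
  is_norm N -> N (- v) = N v.
Proof. by case=> _ NZ _; rewrite -scaleN1r NZ normrN1 mul1r. Qed.

Lemma is_norm_ge0 (R : realType) (V : lmodType R) (N : V -> R) (v : V) :
  is_norm N -> 0 <= N v.
Proof.
move=> Nn; have := is_norm0 _ _ _ Nn; case: (Nn) => _ _ /(_ v (- v)).
by rewrite subrr is_normN//; lra.
Qed.

Lemma is_norm_dist (R : realType) (V : lmodType R) (N : V -> R) (v w : V) :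
  is_norm N -> `|N v - N w| <= N (v - w).
Proof.
move=> Nn; have [_ _ ND] := Nn.
have h1 := ND (v - w) w; rewrite subrK in h1.
have h2 := ND (w - v) v; rewrite subrK in h2.
have h3 : N (w - v) = N (v - w) by rewrite -(is_normN _ _ _ _ Nn) opprB.
by rewrite ler_norml; lra.
Qed.

Lemma normr_is_norm (R : realType) (V : normedModType R) :
  is_norm (Num.norm : V -> R).
Proof.
by split=> [v /normr0_eq0|t v|v w]//; [exact: normrZ|exact: ler_normD].
Qed.

Lemma lipschitz_continuous (R : realType) (V : normedModType R) (f : V -> R)
    (k : R) : (forall v w, `|f v - f w| <= k * `|v - w|) -> continuous f.
Proof.
move=> fk v; apply/cvgrPdist_lt => e e0.
have k0 : 0 < `|k| + 1 by rewrite ltr_wpDl.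
near=> w.
apply: (le_lt_trans (fk v w)).
apply: (@le_lt_trans _ _ ((`|k| + 1) * `|v - w|)).
  by rewrite ler_wpM2r// (le_trans (ler_norm _))// lerDl.
rewrite mulrC -ltr_pdivlMr//; near: w.
by apply: cvgr_dist_lt => //; rewrite divr_gt0.
Unshelve. all: by end_near.
Qed.

Lemma row_coord_le (R : realType) (n : nat) (a : 'rV[R]_n) (i : 'I_n) :
  `|a ord0 i| <= `|a|.
Proof.
by rewrite [leRHS]mx_normrE; apply/bigmax_geP; right => /=; exists (ord0, i).
Qed.

Lemma row_norm_le (R : realType) (n : nat) (N : 'rV[R]_n -> R) (a : 'rV[R]_n) :
  is_norm N -> N a <= (\sum_i N (delta_mx ord0 i)) * `|a|.
Proof.
move=> Nn; have [_ NZ ND] := Nn.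
rewrite {1}(row_sum_delta a) mulr_suml.
apply: (@le_trans _ _ (\sum_i N (a ord0 i *: delta_mx ord0 i))).
  by apply: (big_ind2 (fun u v => N u <= v)) => [|u s v t us vt|//];
    [rewrite is_norm0|exact: le_trans (ND _ _) (lerD us vt)].
apply: ler_sum => i _; rewrite NZ mulrC ler_wpM2l ?is_norm_ge0//.
exact: row_coord_le.
Qed.

Lemma row_norm_continuous (R : realType) (n : nat) (N : 'rV[R]_n -> R) :
  is_norm N -> continuous N.
Proof.
move=> Nn; apply: (@lipschitz_continuous _ _ _ (\sum_i N (delta_mx ord0 i))).
by move=> v w; apply: le_trans (row_norm_le _ _ _ _ Nn); exact: is_norm_dist.
Qed.

(** [N] attains a positive minimum on the compact unit sphere of the max norm; its inverse is the
    constant. *)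
Lemma row_norm_ge (R : realType) (n : nat) (N : 'rV[R]_n -> R) :
  is_norm N -> exists2 k : R, 0 < k & forall a, `|a| <= k * N a.
Proof.
move=> Nn; have [N0 NZ ND] := Nn.
pose S := [set a : 'rV[R]_n | `|a| = 1].
have NS (a : 'rV[R]_n) : a != 0 -> S (`|a|^-1 *: a).
  move=> a0; rewrite /S/= normrZ normfV normr_id mulVf//.
  by rewrite normr_eq0.
(* The sphere is empty for [n = 0], when every row vector is zero. *)
have [S0|] := pselect (S !=set0); last first.
  move=> S0; exists 1 => // a; rewrite mul1r.
  have [->|a0] := eqVneq a 0; first by rewrite normr0 is_norm_ge0.
  by exfalso; apply: S0; eexists; exact: NS a0.
have cS : compact S.
  apply: bounded_closed_compact.
    by exists 1; split=> // M M1 a /= ->; exact: ltW.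
  apply: (@closed_comp _ _ (Num.norm : 'rV[R]_n -> R) [set r | r = 1]).
    by move=> a _; exact: norm_continuous.
  exact: closed_eq.
have [|c /set_mem Sc cmin] := compact_EVT_min S0 cS (f := N).
  by apply: continuous_subspaceT; exact: row_norm_continuous.
have Nc : 0 < N c.
  rewrite lt_neqAle is_norm_ge0// andbT eq_sym; apply/eqP => /N0 c0.
  by move: Sc; rewrite /S/= c0 normr0 => /esym/eqP; rewrite oner_eq0.
exists (N c)^-1; first by rewrite invr_gt0.
move=> a; have [->|a0] := eqVneq a 0.
  by rewrite normr0 mulr_ge0 ?invr_ge0 ?is_norm_ge0.
rewrite mulrC ler_pdivlMr//.
have := cmin _ (mem_set (NS _ a0)); rewrite NZ normfV normr_id.
by rewrite mulrC ler_pdivlMr ?normr_gt0// mulrC.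
Qed.

Lemma row_norm_ball_compact (R : realType) (n : nat) (N : 'rV[R]_n -> R)
    (theta : R) : is_norm N -> compact [set a | N a <= theta].
Proof.
move=> Nn; have [k k0 kN] := row_norm_ge _ _ _ Nn.
apply: bounded_closed_compact.
  exists (k * theta); split; first exact: num_real.
  move=> M M1 a /= Na; apply: le_trans (kN a) (le_trans _ (ltW M1)).
  by rewrite ler_pM2l.
apply: (@closed_comp _ _ N [set r | r <= theta]) => [a _|].
  exact: row_norm_continuous.
exact: closed_le.
Qed.

(** * Inner products, dual norms and operator norms *)

Lemma dotvDr (R : realType) (n : nat) (a e d : 'rV[R]_n) :
  dotv a (e + d) = dotv a e + dotv a d.
Proof.
by rewrite /dotv -big_split/=; apply: eq_bigr => i _; rewrite mxE mulrDr.
Qed.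

Lemma dotvZr (R : realType) (n : nat) (t : R) (a e : 'rV[R]_n) :
  dotv a (t *: e) = t * dotv a e.
Proof.
by rewrite /dotv mulr_sumr; apply: eq_bigr => i _; rewrite mxE mulrCA.
Qed.

Lemma dotvC (R : realType) (n : nat) (a e : 'rV[R]_n) : dotv a e = dotv e a.
Proof. by rewrite /dotv; apply: eq_bigr => i _; rewrite mulrC. Qed.

Lemma dotvBr (R : realType) (n : nat) (a e d : 'rV[R]_n) :
  dotv a (e - d) = dotv a e - dotv a d.
Proof. by rewrite dotvDr -scaleN1r dotvZr mulN1r. Qed.

Lemma dotvBl (R : realType) (n : nat) (a e d : 'rV[R]_n) :
  dotv (a - e) d = dotv a d - dotv e d.
Proof. by rewrite ![dotv _ d]dotvC dotvBr. Qed.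

Lemma dotvZl (R : realType) (n : nat) (t : R) (a e : 'rV[R]_n) :
  dotv (t *: a) e = t * dotv a e.
Proof. by rewrite dotvC dotvZr dotvC. Qed.

Lemma dotv_affinel (R : realType) (n : nat) (e : 'rV[R]_n) :
  affine_fun (dotv^~ e).
Proof. by move=> s t a d _; rewrite ![dotv _ e]dotvC dotvDr !dotvZr. Qed.

Lemma dotv_norm_le (R : realType) (n : nat) (a e : 'rV[R]_n) :
  `|dotv a e| <= (\sum_i `|e ord0 i|) * `|a|.
Proof.
rewrite mulr_suml; apply: (le_trans (ler_norm_sum _ _ _)).
apply: ler_sum => i _; rewrite normrM mulrC ler_wpM2l//.
exact: row_coord_le.
Qed.

Lemma dual_norm_ge0 (R : realType) (X : lmodType R) (C : Type)
    (N : X -> R) (p : X -> C -> R) (c : C) :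
  is_norm N -> p 0 c = 0 -> (0 <= dual_norm N p c)%E.
Proof.
move=> Nn p0; apply: ereal_sup_ubound; exists 0; last by rewrite p0.
by rewrite /= is_norm0.
Qed.

Lemma dual_norm_ub (R : realType) (X : lmodType R) (C : Type)
    (N : X -> R) (p : X -> C -> R) (u : X) (c : C) :
  is_norm N -> (forall t v, p (t *: v) c = t * p v c) ->
  ((p u c)%:E <= dual_norm N p c * (N u)%:E)%E.
Proof.
move=> Nn pZ; have [N0 NZ ND] := Nn.
have p0 : p 0 c = 0 by rewrite -(scale0r 0) pZ mul0r.
(* The dual norm may be [+oo], but its product with [0] is [0] by convention. *)
have [->|u0] := eqVneq u 0; first by rewrite p0 is_norm0// mule0.
have Nu : 0 < N u.
  rewrite lt_neqAle is_norm_ge0// andbT eq_sym.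
  by apply: contra u0 => /eqP/N0/eqP.
rewrite -lee_pdivrMr// -EFinM mulrC -pZ; apply: ereal_sup_ubound.
exists ((N u)^-1 *: u) => //=.
by rewrite NZ gtr0_norm ?invr_gt0// mulVf// gt_eqF.
Qed.

Lemma dual_norm_dotv_fin_num (R : realType) (n : nat) (N : 'rV[R]_n -> R)
    (e : 'rV[R]_n) : is_norm N -> dual_norm N dotv e \is a fin_num.
Proof.
move=> Nn; have [k k0 kN] := row_norm_ge _ _ _ Nn.
rewrite ge0_fin_numE; last first.
  by rewrite dual_norm_ge0// -(scale0r 0) dotvZl mul0r.
apply: (@le_lt_trans _ _ ((\sum_i `|e ord0 i|) * k)%:E); last exact: ltry.
apply: ge_ereal_sup => _ [a /= Na <-]; rewrite lee_fin.
apply: le_trans (ler_norm _) (le_trans (dotv_norm_le _ _ _ _) _).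
apply: ler_wpM2l; first exact: sumr_ge0.
by apply: le_trans (kN a) _; rewrite -[leRHS]mulr1 ler_pM2l.
Qed.

Lemma dual_norm_dotvB (R : realType) (n : nat) (N : 'rV[R]_n -> R)
    (e d : 'rV[R]_n) :
  (dual_norm N dotv e <= dual_norm N dotv (e - d)%R + dual_norm N dotv d)%E.
Proof.
apply: ge_ereal_sup => _ [a Na <-]; rewrite -[e in dotv a e](subrK d) dotvDr.
by rewrite EFinD; apply: leeD; apply: ereal_sup_ubound; exists a.
Qed.

Lemma op_norm_ge0 (R : realType) (X B : normedModType R) (A : {linear X -> B}) :
  (0 <= op_norm A)%E.
Proof.
by apply: ereal_sup_ubound; exists 0; rewrite /= ?normr0// linear0 normr0.
Qed.

Lemma op_norm_ub (R : realType) (X B : normedModType R) (A : {linear X -> B})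
    (u : X) : (`|A u|%:E <= op_norm A * `|u|%:E)%E.
Proof.
have [->|u0] := eqVneq u 0; first by rewrite linear0 !normr0 mule0.
have Nu : 0 < `|u| by rewrite normr_gt0.
rewrite -lee_pdivrMr// -EFinM mulrC; apply: ereal_sup_ubound.
exists (`|u|^-1 *: u) => /=.
  by rewrite normrZ gtr0_norm ?invr_gt0// mulVf ?gt_eqF.
by rewrite linearZ normrZ gtr0_norm ?invr_gt0.
Qed.

(** * Strong duality for the restricted program *)

Lemma bilinear_sumZl (R : realType) (X C : lmodType R)
    (p : {bilinear X -> C -> R | *%R & *%R}) (n : nat) (x : 'I_n -> X)
    (a : 'rV[R]_n) (c : C) :
  p (\sum_i a ord0 i *: x i) c = dotv a (\row_i p (x i) c).
Proof.
rewrite (big_morph (p^~ c) (linearDl p c) (linear0l p c)).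
by apply: eq_bigr => i _; rewrite linearZl_LR/= mxE.
Qed.

Lemma dual_cone_convex (R : realType) (B Y : lmodType R)
    (q : {bilinear B -> Y -> R | *%R & *%R}) (K : set B) :
  convex_set (dual_cone q K : set (convex_lmodType Y)).
Proof.
apply/convex_setP => s t u v s0 t0 _ Ku Kv z Kz.
by rewrite linearDr/= !linearZr_LR/= addr_ge0// mulr_ge0 ?Ku ?Kv.
Qed.

(** The strict gap between [t] and the infimum makes the shifted Lagrangian strictly positive for a
    suitable multiplier, an open condition in [a], as the compactness argument requires. *)
Lemma Pn_strong_duality (R : realType) (X C B Y : lmodType R)
    (p : {bilinear X -> C -> R | *%R & *%R})
    (q : {bilinear B -> Y -> R | *%R & *%R})
    (A : X -> B) (K : set B) (c : C) (b : B) (n : nat) (x : 'I_n -> X)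
    (N : 'rV[R]_n -> R) (thetaP t : R) :
  convex_cone K -> weakly_closed q K -> K !=set0 -> is_norm N -> 0 < thetaP ->
  (t%:E < inf_Pn p A K c b x N thetaP)%E ->
  exists2 y, dual_cone q K y & (t%:E <= objDn p q A c b x N thetaP y)%E.
Proof.
move=> cK clK K0 Nn theta0 tJ.
have [_ NZ ND] := Nn.
(* the Lagrangian of (P_n), shifted by [t] *)
pose F (a : 'rV[R]_n) (y : Y) :=
  dotv a (cvec p x c) + q (b - An A x a) y - t.
have FE a y :
    F a y = dotv a (cvec p x c - An_adj q A x y) + (q b y - t).
  by rewrite /F linearBl/= bilinear_sumZl dotvBr /An_adj; ring.
have K'0 : dual_cone q K 0 by move=> z _; rewrite linear0r.
pose D := [set a : 'rV[R]_n | N a <= thetaP].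
have Fex a : D a -> exists2 y, dual_cone q K y & 0 < F a y.
  move=> Da; have [KA|KA] := pselect (K (An A x a - b)).
    exists 0 => //; rewrite /F linear0r addr0 subr_gt0 -lte_fin.
    by apply: lt_le_trans tJ _; apply: ereal_inf_lbound; exists a.
  have [y Ky qy] := dual_cone_separation _ _ _ _ _ _ cK clK K0 KA.
  have qy0 : 0 < q (b - An A x a) y by rewrite -opprB linearNl/= oppr_gt0.
  (* The separating [y] is rescaled so that its penalty term equals [m], which exceeds
     [t - dotv a (cvec p x c)]. *)
  pose m := `|t - dotv a (cvec p x c)| + 1.
  have m0 : 0 < m by rewrite ltr_wpDl.
  exists ((m / q (b - An A x a) y) *: y).
    by move=> z Kz; rewrite linearZr_LR/= mulr_ge0 ?Ky// divr_ge0 ?ltW.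
  rewrite /F linearZr_LR/= divfK ?gt_eqF//.
  by have := ler_norm (t - dotv a (cvec p x c)); rewrite /m; lra.
have : compact D by exact: row_norm_ball_compact.
rewrite compact_cover => /(_ Y (dual_cone q K) (fun y => [set a | 0 < F a y])).
case=> [y _||ys ysK Dys].
- apply: (@open_comp _ _ (F^~ y) [set r | 0 < r]); last exact: open_gt.
  move=> a _; apply: (@lipschitz_continuous _ _ _
    (\sum_i `|(cvec p x c - An_adj q A x y) ord0 i|)) => v w.
  by rewrite !FE opprD addrACA subrr addr0 -dotvBl; exact: dotv_norm_le.
- by move=> a /Fex[y Ky Fy]; exists y.
have [|||||||y Ky Fy] := @finite_minimax _ _ _ D (dual_cone q K) F (finmap.enum_fset ys).
- apply/convex_setP => s r u v s0 r0 sr Du Dv.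
  apply: le_trans (ND _ _) _; rewrite !NZ !ger0_norm//.
  rewrite -[leRHS]mul1r -sr mulrDl.
  by apply: lerD; apply: ler_wpM2l.
- exact: dual_cone_convex.
- by exists 0.
- move=> y s r u v sr; rewrite !FE dotv_affinel//.
  have -> : r = 1 - s by lra.
  by ring.
- move=> a s r u v sr; rewrite /F bilinear_affiner//.
  have -> : r = 1 - s by lra.
  by ring.
- by move=> y /ysK/set_mem.
- by move=> a /Dys[y /= yys Fy]; exists y => //; exact: ltW.
have dfin := dual_norm_dotv_fin_num _ _ _ (An_adj q A x y - cvec p x c) Nn.
(* The ball of radius [thetaP] consists of the [thetaP *: a] with [N a <= 1], so minimizing the
   Lagrangian over it produces the dual norm term of the objective. *)
exists y => //; rewrite /objDn leeBrDr ?fin_numM// addeC -leeBrDr//.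
rewrite -EFinB -lee_pdivlMl// -EFinM.
apply: ge_ereal_sup => _ [a /= Na <-]; rewrite lee_fin ler_pdivlMl//.
have : D (thetaP *: a).
  by rewrite /D/= NZ gtr0_norm// -[leRHS]mulr1 ler_pM2l.
by move=> /Fy; rewrite FE dotvZl -opprB -scaleN1r dotvZr; lra.
Qed.

(** * The two error bounds *)

Theorem theorem3p3 (R : realType)
    (X : normedModType R) (C : lmodType R)
    (B : normedModType R) (Y : lmodType R)
    (p : {bilinear X -> C -> R | *%R & *%R})
    (q : {bilinear B -> Y -> R | *%R & *%R})
    (p_sep : separating p) (q_sep : separating q)
    (A : {linear X -> B}) (Astar : Y -> C)
    (A_cont : weakly_continuous p q A)
    (A_adj : adjoint_of p q A Astar)
    (K : set B) (K_cone : convex_cone K) (K_closed : weakly_closed q K)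
    (c : C) (b : B)
    (n : nat) (x : 'I_n -> X)
    (x_indep : lin_indep x) (x_norm : forall i, `|x i| = 1)
    (N : 'rV[R]_n -> R) (N_norm : is_norm N)
    (thetaP : R) (thetaP_gt0 : 0 < thetaP)
    (xopt : X) (xopt_min : minimizer (feasP A K b) (fun x' => p x' c) xopt)
    (yopt : Y)
    (yopt_max : maximizer (dual_cone q K) (objDn p q A c b x N thetaP) yopt)
    (proj : X)
    (proj_min : minimizer (Bn x N thetaP) (fun x' => `|x' - xopt|) proj)
    (Pn_feasible : feasPn A K b x N thetaP !=set0) :
  let J := inf_P p A K c b in
  let Jn := inf_Pn p A K c b x N thetaP in
  let r := xopt - proj in
  (0 <= Jn - J <= (p r (Astar yopt - c))%:E)%E /\
  (forall gamma JLB : R,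
    0 < gamma ->
    (forall y : Y, dual_cone q K y ->
      (gamma%:E * dual_norm Num.norm q y
         <= dual_norm N dotv (An_adj q A x y))%E) ->
    `|b| < gamma * thetaP ->
    (JLB%:E <= Jn)%E ->
    (0 <= Jn - J <=
       (dual_norm Num.norm p c
        + thetaD p c b x N thetaP gamma JLB * op_norm A) * `|r|%:E)%E).
Proof.
move=> J Jn r.
have [xfeas xmin] := xopt_min; have [ycone ymax] := yopt_max.
have [[a0 /= Na0 proj_eq] _] := proj_min.
have JE : J = (p xopt c)%:E.
  apply/eqP; rewrite eq_le ereal_inf_lbound; last by exists xopt.
  by apply: le_ereal_inf_tmp => _ [u uf <-]; rewrite lee_fin xmin.
have JnJ : (J <= Jn)%E.
  apply: le_ereal_inf_tmp => _ [a [Ka _] <-].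
  apply: ereal_inf_lbound; exists (\sum_i a ord0 i *: x i).
    rewrite /feasP/= linear_sum; under eq_bigr do rewrite linearZ.
    exact: Ka.
  by rewrite bilinear_sumZl.
have [jn JnE] : exists jn : R, Jn = jn%:E.
  have [a fa] := Pn_feasible.
  have : (Jn <= (dotv a (cvec p x c))%:E)%E by apply: ereal_inf_lbound; exists a.
  by move: JnJ; rewrite JE; case: Jn => [s _ _|//|//]; exists s.
pose dn e := fine (dual_norm N dotv e).
have dnE e : dual_norm N dotv e = (dn e)%:E.
  by rewrite fineK// dual_norm_dotv_fin_num.
have objE y : objDn p q A c b x N thetaP y =
    (q b y - thetaP * dn (An_adj q A x y - cvec p x c))%:E.
  by rewrite /objDn dnE.
have strong : jn <= q b yopt - thetaP * dn (An_adj q A x yopt - cvec p x c).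
  (* Otherwise the midpoint of the dual optimum and [jn] lies below [jn], and strong duality gives a
     multiplier beating [yopt]. *)
  rewrite leNgt; apply/negP => /midf_lt[] ? mJ.
  have K0 : K !=set0 by exists (A xopt - b).
  have [||y Ky] := @Pn_strong_duality _ _ _ _ _ p q A K c b _ x N thetaP
    ((q b yopt - thetaP * dn (An_adj q A x yopt - cvec p x c) + jn) / 2)
    K_cone K_closed K0 N_norm.
  - by [].
  - by rewrite -/Jn JnE lte_fin.
  by move=> /le_trans/(_ (ymax _ Ky)); rewrite objE lee_fin; lra.
have qby : q b yopt <= p xopt (Astar yopt).
  by rewrite -A_adj -subr_ge0 -linearBl; exact: ycone.
have dotv_le u e : dotv u e <= dn e * N u.
  rewrite -lee_fin EFinM -dnE; apply: dual_norm_ub => // t v.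
  exact: dotvZl.
have gap0 : (0 <= Jn - J)%E by rewrite JE suber_ge0// -JE.
(* By [strong] and [qby], [jn] is at most [p xopt (Astar yopt)] minus the penalty. The penalty
   dominates [p proj (Astar yopt - c)], since [proj] has coefficients [a0] with [N a0 <= thetaP]. *)
have gap : jn - p xopt c <= p r (Astar yopt - c).
  have dn0 : 0 <= dn (An_adj q A x yopt - cvec p x c).
    rewrite -lee_fin -dnE dual_norm_ge0//.
    by rewrite -(scale0r 0) dotvZl mul0r.
  have prE : p proj (Astar yopt - c) =
      dotv a0 (An_adj q A x yopt - cvec p x c).
    rewrite -proj_eq bilinear_sumZl; congr dotv; apply/rowP => i.
    by rewrite !mxE linearBr/= A_adj.
  have := dotv_le a0 (An_adj q A x yopt - cvec p x c).
  have := ler_wpM2l dn0 Na0.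
  rewrite /r linearBl/= prE linearBr/=; lra.
split; first by rewrite gap0 JE JnE -EFinB lee_fin.
move=> gamma JLB gamma0 gammaP bgamma JLBJn; rewrite gap0 /=.
have nn (V : normedModType R) := normr_is_norm R V.
pose dy := fine (dual_norm Num.norm q yopt).
have dy_ge0 : (0 <= dual_norm Num.norm q yopt)%E.
  by rewrite dual_norm_ge0 ?linear0l.
have dyE : dual_norm Num.norm q yopt = dy%:E.
  (* An infinite dual norm of [yopt] would make the left side of [gammaP] infinite, while its right
     side is finite. *)
  rewrite fineK// ge0_fin_numE//.
  have := gammaP _ ycone; rewrite dnE.
  by case: (dual_norm _ _ _) dy_ge0 => //= [s|] _; rewrite ?ltry// gt0_muley.
have dy0 : 0 <= dy by rewrite -lee_fin -dyE.
pose D := gamma * thetaP - `|b|.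
have D0 : 0 < D by rewrite /D subr_gt0.
pose tD := (thetaP * dn (cvec p x c) - JLB) / D.
have tDE : thetaD p c b x N thetaP gamma JLB = tD%:E.
  by rewrite /thetaD dnE inver gt_eqF.
(* Chain: [thetaP * gamma * dy] is at most [thetaP] times the dual norms of the residual and of
   [cvec p x c]; [strong] bounds the residual term by [q b yopt - jn], which is at most
   [dy * |b| - JLB]. Collecting [dy] leaves the factor [D]. *)
have dy_le : dy <= tD.
  rewrite /tD ler_pdivlMr// /D.
  have h1 : gamma * dy <= dn (An_adj q A x yopt).
    by rewrite -lee_fin EFinM -dyE -dnE; exact: gammaP.
  have h2 : dn (An_adj q A x yopt)
      <= dn (An_adj q A x yopt - cvec p x c) + dn (cvec p x c).
    by rewrite -lee_fin EFinD -!dnE dual_norm_dotvB.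
  have h3 : q b yopt <= dy * `|b|.
    rewrite -lee_fin EFinM -dyE; apply: dual_norm_ub => // t v.
    by rewrite linearZl_LR.
  have h4 : JLB <= jn by rewrite -lee_fin -JnE.
  have := ler_wpM2l (ltW thetaP_gt0) h1.
  have := ler_wpM2l (ltW thetaP_gt0) h2.
  by move: strong; lra.
have tD0 : 0 <= tD by exact: le_trans dy_le.
(* [dual_norm Num.norm p c] and [op_norm A] may be [+oo], so distributing the product rests on
   nonnegativity. *)
rewrite JE JnE -EFinB tDE ge0_muleDl; first last.
- by rewrite mule_ge0// ?op_norm_ge0// lee_fin.
- by rewrite dual_norm_ge0 ?linear0l.
(* The minus sign is moved onto [r] because the dual norm bounds pairings from above; [- r] has the
   same norm. *)
apply: (@le_trans _ _ (p (- r) c + q (A r) yopt)%:E).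
  rewrite lee_fin (le_trans gap)// linearBr/= linearNl/= A_adj.
  by lra.
rewrite EFinD; apply: leeD.
  rewrite -(normrN r); apply: dual_norm_ub => // t v.
  by rewrite linearZl_LR.
apply: (@le_trans _ _ (dy%:E * `|A r|%:E)%E).
  rewrite -dyE; apply: dual_norm_ub => // t v.
  by rewrite linearZl_LR.
rewrite -muleA; apply: lee_pmul; rewrite ?lee_fin//.
exact: op_norm_ub.
Qed.
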